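(* Let $n\ge1$, $\alpha\in(1,\infty)$, let $K$ be a homogeneous Calderón–Zygmund kernel on $\mathbb{R}^n$ that is not identically zero (as in the context), and let $\mathcal{H}^{(u)}f(x)=\int_{\mathbb{R}^n}f(x-t)e^{iu|t|^\alpha}K(t)\,dt$, $u\in\mathbb{R}$. Let $p\in(1,\infty)$ and $r\in[1,\infty)$. If $r<\frac{p'}{n}$, then the estimate $$\left\|V^r\{\mathcal{H}^{(u)}f: u\in\mathbb{R}\}\right\|_{L^p(\mathbb{R}^n)}\le C\|f\|_{L^p(\mathbb{R}^n)}$$ fails; that is, there is no finite constant $C$ for which it holds for all Schwartz functions $f$ on $\mathbb{R}^n$.
   Context: $p'=p/(p-1)$ is the conjugate exponent. A homogeneous Calderón–Zygmund kernel is $K(x)=\mathrm{p.v.}\,\frac{\Omega(x)}{|x|^n}$ where $\Omega$ is a real-valued function, smooth on $\mathbb{R}^n\setminus\{0\}$, homogeneous of degree $0$, with $\int_{\mathbb{S}^{n-1}}\Omega\,d\sigma=0$ ($\sigma$ is surface measure on $\mathbb{S}^{n-1}$; for $n=1$ this means $\Omega(1)+\Omega(-1)=0$). The integral defining $\mathcal{H}^{(u)}f$ is taken in the principal value sense at $t=0$. For a family of complex numbers $\{a_u\}_{u\in\mathcal{J}}$, $\mathcal{J}\subset\mathbb{R}$, and $1\le r<\infty$, $$V^r\{a_u:u\in\mathcal{J}\}=\sup_{J\in\mathbb{N}}\ \sup_{u_0<u_1<\dots<u_J,\ u_i\in\mathcal{J}}\Big(\sum_{j=1}^J|a_{u_j}-a_{u_{j-1}}|^r\Big)^{1/r},$$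 taken pointwise in $x$ for a family of functions. *)

(* Defs.v *)
From HB Require Import structures.
From mathcomp Require Import all_boot all_order all_algebra.
From mathcomp Require Import complex.
From mathcomp Require Import all_classical all_reals all_analysis.
From mathcomp Require Import measurable_realfun.
Import Order.TTheory GRing.Theory Num.Theory.
Import numFieldNormedType.Exports.

Set Implicit Arguments.
Unset Strict Implicit.
Unset Printing Implicit Defensive.

Local Open Scope classical_set_scope.
Local Open Scope ring_scope.

(* R^n is 'rV[R]_n, with the sigma-algebra generated by the coordinate
   functions, i.e. the Borel sigma-algebra. *)
Section rV_measurable.
Context {R : realType} {n : nat}.

Let coords : 'I_n -> 'rV[R]_n -> measurableTypeR R := fun i x => x 0 i.

Let rV_set0 : g_sigma_preimage coords set0.
Proof. exact: sigma_algebra0. Qed.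

Let rV_setC A : g_sigma_preimage coords A -> g_sigma_preimage coords (~` A).
Proof. exact: sigma_algebraC. Qed.

Let rV_bigcup (F : (set 'rV[R]_n)^nat) :
  (forall i, g_sigma_preimage coords (F i)) ->
  g_sigma_preimage coords (\bigcup_i F i).
Proof. exact: sigma_algebra_bigcup. Qed.

HB.instance Definition _ := @isMeasurable.Build default_measure_display
  'rV[R]_n (g_sigma_preimage coords) rV_set0 rV_setC rV_bigcup.

Lemma measurable_coord (i : 'I_n) :
  measurable_fun [set: 'rV[R]_n] (fun x : 'rV[R]_n => x 0 i : measurableTypeR R).
Proof.
move=> _ Y mY; rewrite setTI; apply: sub_sigma_algebra => /=.
rewrite -bigcup_seq/=; exists i => /=; first by rewrite mem_index_enum.
by exists Y => //; rewrite setTI.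
Qed.

Lemma measurable_fun_coordP d (T : measurableType d) (f : T -> 'rV[R]_n) :
  measurable_fun [set: T] f <->
  forall i, measurable_fun [set: T] (fun t => f t 0 i : measurableTypeR R).
Proof.
split=> [mf i|mf].
  exact: (measurableT_comp (measurable_coord i) mf).
move=> _ B mB; rewrite setTI.
suff : g_sigma_preimage coords `<=` [set A | measurable (f @^-1` A)] by exact.
apply: smallest_sub => /=.
  split => /=.
  - by rewrite preimage_set0.
  - by move=> A mA; rewrite setTD preimage_setC; exact: measurableC.
  - by move=> F mF; rewrite preimage_bigcup; exact: bigcup_measurable.
move=> A; rewrite -bigcup_seq => -[i _ [C mC <-]] /=.
rewrite setTI -[X in measurable X]setTI; exact: mf.
Qed.

End rV_measurable.

Section lebesgue_rV.
Context {R : realType}.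

Section product_step.
Context {n : nat}.

Definition cons_rV (z : R * 'rV[R]_n) : 'rV[R]_n.+1 :=
  row_mx (z.1)%:M z.2 : 'rV[R]_(1 + n).

Lemma measurable_cons_rV : measurable_fun setT cons_rV.
Proof.
apply/measurable_fun_coordP => i; rewrite /cons_rV.
case: (@splitP 1 n i) => j ij.
- rewrite (_ : (fun _ => _) = fst); first exact: measurable_fst.
  apply/funext => z; have -> : i = lshift n j by exact: val_inj.
  by rewrite [LHS](@row_mxEl _ 1 1 n) (ord1 j) mxE eqxx mulr1n.
- rewrite (_ : (fun _ => _) = (fun v : 'rV[R]_n => v 0 j) \o snd); last first.
    apply/funext => z; have -> : i = rshift 1 j by exact: val_inj.
    by rewrite [LHS](@row_mxEr _ 1 1 n).
  by apply: measurableT_comp => //; exact: measurable_coord.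
Qed.

Variable mu : {measure set 'rV[R]_n -> \bar R}.

Definition leb_cons : set 'rV[R]_n.+1 -> \bar R :=
  pushforward (lebesgue_measure \x^ mu)%E cons_rV.

Let leb_cons0 : leb_cons set0 = 0%E.
Proof. by rewrite /leb_cons measure0//; exact: measurable_cons_rV. Qed.

Let leb_cons_ge0 A : (0 <= leb_cons A)%E.
Proof. by apply: measure_ge0; exact: measurable_cons_rV. Qed.

Let leb_cons_sigma_additive : semi_sigma_additive leb_cons.
Proof.
by apply: measure_semi_sigma_additive; exact: measurable_cons_rV.
Qed.

HB.instance Definition _ := isMeasure.Build _ _ _ leb_cons
  leb_cons0 leb_cons_ge0 leb_cons_sigma_additive.

End product_step.

(* Lebesgue measure on R^n (on Borel sets), as the n-fold product of Lebesgue
   measure on R. *)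
Fixpoint leb (n : nat) : {measure set 'rV[R]_n -> \bar R} :=
  match n with
  | 0 => \d_ (0 : 'rV[R]_0)
  | m.+1 => leb_cons (leb m)
  end.

Lemma leb_box n (A : 'I_n -> set (measurableTypeR R)) :
  (forall i, measurable (A i)) ->
  leb n [set x | forall i, A i (x 0 i)] =
    (\prod_(i < n) lebesgue_measure (A i))%E.
Proof.
elim: n A => [|n IHn] A mA.
  rewrite big_ord0 /= diracE mem_set//= => -[]//.
rewrite big_ord_recl -IHn; last by move=> i; exact: mA.
have mB : measurable [set x : 'rV[R]_n | forall i, A (lift ord0 i) (x 0 i)].
  rewrite [X in measurable X](_ : _ =
      \bigcap_(i in [set` index_enum 'I_n])
        ((fun x : 'rV[R]_n => x 0 i) @^-1` A (lift ord0 i))).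
    rewrite bigcap_seq; apply: bigsetI_measurable => i _.
    by rewrite -[X in measurable X]setTI; apply: measurable_coord.
  apply/seteqP; split => x /= xA i; first by move=> _; exact: xA.
  exact: (xA i (mem_index_enum i)).
rewrite -[RHS](product_measure2E _ _ (mA ord0) mB) /= /leb_cons /pushforward.
congr (_ _); apply/seteqP; split => -[x y] /=.
  move=> xyA; split => [|i].
    have := xyA (lshift n ord0 : 'I_(1 + n)).
    rewrite /cons_rV (@row_mxEl _ 1 1 n) mxE eqxx mulr1n.
    by rewrite (_ : lshift n ord0 = ord0)//; exact: val_inj.
  have := xyA (rshift 1 i : 'I_(1 + n)).
  rewrite /cons_rV (@row_mxEr _ 1 1 n).
  by rewrite (_ : rshift 1 i = lift ord0 i)//; exact: val_inj.
move=> [xA yA] i; rewrite /cons_rV.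
case: (@splitP 1 n i) => j ij.
  have iE : i = lshift n j by exact: val_inj.
  rewrite iE (@row_mxEl _ 1 1 n) (ord1 j) mxE eqxx mulr1n.
  by rewrite (_ : lshift n 0 = ord0)//; exact: val_inj.
have iE : i = rshift 1 j by exact: val_inj.
rewrite iE (@row_mxEr _ 1 1 n) (_ : rshift 1 j = lift ord0 j)//.
exact: val_inj.
Qed.

End lebesgue_rV.

Section euclidean.
Context {R : realType} {n : nat}.
Implicit Types x : 'rV[R]_n.

(* The norm `|x| of the library on 'rV[R]_n is the sup norm. *)
Definition enorm x : R := Num.sqrt (\sum_(i < n) x 0 i ^+ 2).

Lemma measurable_enorm : measurable_fun setT enorm.
Proof.
have -> : enorm = @powR R ^~ 2^-1 \o (fun x => \sum_(i < n) x 0 i ^+ 2).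
  apply/funext => x; rewrite /= powR12_sqrt//.
  by apply: sumr_ge0 => i _; exact: sqr_ge0.
apply: measurableT_comp; first exact: measurable_powR.
apply: measurable_sum => i; apply: measurable_funX; exact: measurable_coord.
Qed.

Definition unit_sphere : set 'rV[R]_n := [set x | enorm x = 1].

Definition punctured_ball : set 'rV[R]_n := [set x | 0 < enorm x <= 1].

Lemma measurable_punctured_ball : measurable punctured_ball.
Proof.
rewrite (_ : punctured_ball = enorm @^-1` `]0, 1]%classic); last first.
  by apply/seteqP; split => x; rewrite /punctured_ball/= in_itv.
rewrite -[X in measurable X]setTI.
by apply: measurable_enorm => //; exact: measurable_itv.
Qed.

Definition direction x : 'rV[R]_n := (enorm x)^-1 *: x.

Lemma measurable_direction : measurable_fun setT direction.
Proof.
apply/measurable_fun_coordP => i.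
rewrite (_ : (fun _ => _) = (fun x => (enorm x)^-1) \* (fun x => x 0 i)); last first.
  by apply/funext => x; rewrite /direction mxE.
apply: measurable_funM; last exact: measurable_coord.
rewrite (_ : (fun _ => _) = @powR R ^~ (-1) \o enorm); last first.
  by apply/funext => x; rewrite /= powR_inv1// sqrtr_ge0.
by apply: measurableT_comp; [exact: measurable_powR|exact: measurable_enorm].
Qed.

(* Surface measure on the unit sphere, as a measure on R^n carried by the
   sphere: sigma(E) = n * Leb {x | 0 < |x| <= 1, x / |x| \in E}, i.e. the
   measure for which integration in polar coordinates
   dx = s^(n-1) ds dsigma holds. For n = 1 it is the counting measure on
   {-1, 1}. *)
Definition surface_measure : set 'rV[R]_n -> \bar R :=
  fun E => (n%:R%:E * leb n (direction @^-1` E `&` punctured_ball))%E.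

Let nu := pushforward (mrestr (leb n) measurable_punctured_ball) direction.

Let surface0 : surface_measure set0 = 0%E.
Proof.
by rewrite /surface_measure preimage_set0 set0I measure0 mule0.
Qed.

Let surface_ge0 A : (0 <= surface_measure A)%E.
Proof. by apply: mule_ge0. Qed.

Let surface_sigma_additive : semi_sigma_additive surface_measure.
Proof.
have /= := @measure_semi_sigma_additive _ _ _ (mscale n%:R%:nng nu).
by apply; exact: measurable_direction.
Qed.

HB.instance Definition _ := isMeasure.Build _ _ _ surface_measure
  surface0 surface_ge0 surface_sigma_additive.

End euclidean.

Section smooth.
Context {R : realType} {n : nat}.
Implicit Types (f : 'rV[R]_n -> R) (A : set 'rV[R]_n) (s : seq 'I_n).

(* The iterated partial derivative of f along the coordinates listed in s. *)
Definition partials s f : 'rV[R]_n -> R :=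
  foldr (fun i g => 'D_'e_i g) f s.

(* C^infinity on A, for A open. *)
Definition smooth_on A f : Prop :=
  forall s x, A x ->
    {for x, continuous (partials s f)} /\
    forall i, derivable (partials s f) x 'e_i.

Definition real_schwartz f : Prop :=
  smooth_on setT f /\
  forall (k : nat) s, exists C : R,
    forall x, enorm x ^+ k * `|partials s f x| <= C.

Definition schwartz (f : 'rV[R]_n -> R[i]) : Prop :=
  real_schwartz (fun x => complex.Re (f x)) /\
  real_schwartz (fun x => complex.Im (f x)).

End smooth.

Section oscillatory_CZ.
Context {R : realType} {n : nat}.
Implicit Types (K : 'rV[R]_n -> R) (f : 'rV[R]_n -> R[i]).

(* The value of K at 0 is irrelevant. *)
Definition homogeneous_CZ_kernel K : Prop :=
  exists Omega : 'rV[R]_n -> R,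
    [/\ smooth_on [set x | x != 0] Omega,
        forall (c : R) x, 0 < c -> x != 0 -> Omega (c *: x) = Omega x,
        (\int[surface_measure]_(x in unit_sphere) (Omega x)%:E = 0)%E &
        forall x, x != 0 -> K x = Omega x / enorm x ^+ n].

Definition Cintegral (D : set 'rV[R]_n) f : R[i] :=
  ((\int[leb n]_(t in D) complex.Re (f t)) +i*
   (\int[leb n]_(t in D) complex.Im (f t)))%C.

Definition expi (t : R) : R[i] := (cos t +i* sin t)%C.

Definition truncated_osc (alpha : R) K (u : R) f (x : 'rV[R]_n) (e : R) :
    R[i] :=
  Cintegral [set t | e < enorm t]
    (fun t => f (x - t) * expi (u * enorm t `^ alpha) * (K t)%:C%C).

(* Principal value at t = 0; the real and imaginary parts of the limit are taken
   separately. *)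
Definition osc (alpha : R) K (u : R) f (x : 'rV[R]_n) : R[i] :=
  (lim (complex.Re (truncated_osc alpha K u f x e) @[e --> 0^'+]) +i*
   lim (complex.Im (truncated_osc alpha K u f x e) @[e --> 0^'+]))%C.

End oscillatory_CZ.

Definition Vr {R : realType} (r : R) (J : set R) (a : R -> R[i]) :
    \bar R :=
  ereal_sup [set y | exists N (u : nat -> R),
    [/\ forall j, (j <= N)%N -> J (u j),
        forall j, (j < N)%N -> u j < u j.+1 &
        y = ((\sum_(j < N) Normc.normc (a (u j.+1) - a (u j)) `^ r) `^ r^-1)%:E]].

(* Main.v *)
(* Test the inequality on a fixed nonnegative smooth bump f supported in the
   unit cube. If K is nonzero at x0, then by homogeneity K has constant sign
   and size about lam^-n on a cube of side about lam around lam x0. For x in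
   that cube and u_j = pi j / |x|^alpha, with j <= N and N a small multiple of
   lam, the phase u_j |t|^alpha stays within 1 of pi j on the support of
   t |-> f(x - t), so (-1)^j Re H^(u_j) f(x) has constant sign and size at
   least c lam^-n. Hence V^r >= c N^(1/r) lam^-n on a set of measure about
   lam^n, and the p-th power of the left-hand norm is at least
   c lam^(p/r - pn + n), where the exponent is positive because r < p'/n. *)
Require Import Defs.
From HB Require Import structures.
From mathcomp Require Import all_boot all_order all_algebra.
From mathcomp Require Import complex.
From mathcomp Require Import all_classical all_reals all_analysis.
From mathcomp Require Import ring lra.
Set Implicit Arguments.
Unset Strict Implicit.

Import Order.TTheory GRing.Theory Num.Theory.
Import numFieldNormedType.Exports.

Local Open Scope classical_set_scope.
Local Open Scope ring_scope.

(** * Integral bounds for functions of unknown measurability *)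

Section integral_without_measurability.
Context d (T : measurableType d) (R : realType) (mu : {measure set T -> \bar R}).
Implicit Types (D A : set T) (f g : T -> \bar R).
Local Open Scope ereal_scope.

(* The library's [ge0_le_integral] also asks for measurability; monotonicity
   only needs the definition of the integral as a supremum over nonnegative
   simple functions. *)
Lemma nonneg_le_integral D f g :
  (forall x, D x -> 0 <= f x) -> (forall x, D x -> f x <= g x) ->
  \int[mu]_(x in D) f x <= \int[mu]_(x in D) g x.
Proof.
move=> f0 fg.
rewrite !ge0_integralE//; last by move=> x Dx; exact: le_trans (f0 _ Dx) (fg _ Dx).
apply: le_ereal_sup => _ [h /= hf <-]; exists h => //= x.
exact: le_trans (hf x) (lee_restrict fg x).
Qed.

(** Comparison with the function equal to [c] on [A] and 0 elsewhere. It is applied to powers of the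
    variation, a supremum over uncountably many frequencies. *)
Lemma integral_ge_cst D A f (c : R) :
  measurable A -> A `<=` D -> (0 <= c)%R ->
  (forall x, D x -> 0 <= f x) -> (forall x, A x -> c%:E <= f x) ->
  c%:E * mu A <= \int[mu]_(x in D) f x.
Proof.
move=> mA AD c0 f0 cf; rewrite -integral_cst//.
rewrite [leLHS]integral_mkcond [leRHS]integral_mkcond.
apply: nonneg_le_integral => x _; rewrite /patch.
  by case: ifP => // _; rewrite lee_fin.
case: ifPn => [/set_mem Ax|_]; first by rewrite (mem_set (AD _ Ax)); exact: cf.
by case: ifPn => // /set_mem; exact: f0.
Qed.

Lemma integral_le_cst D A f (c : R) :
  measurable A -> (0 <= c)%R ->
  (forall x, D x -> 0 <= f x) -> (forall x, D x -> A x -> f x <= c%:E) ->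
  (forall x, D x -> ~ A x -> f x = 0) ->
  \int[mu]_(x in D) f x <= c%:E * mu A.
Proof.
move=> mA c0 f0 fc fA; rewrite -integral_cst//.
rewrite [leLHS]integral_mkcond [leRHS]integral_mkcond.
apply: nonneg_le_integral => x _; rewrite /patch.
  by case: ifPn => // /set_mem; exact: f0.
case: ifPn => [/set_mem Dx|_]; last by case: ifP => // _; rewrite lee_fin.
by case: ifPn => [/set_mem|/negP] Ax; [exact: fc|rewrite fA// => /mem_set].
Qed.

End integral_without_measurability.

(** * The flat functions t^(-a) exp(-1/t) *)

Section exp_inv.
Context {R : realType}.

(** The negative powers of t are carried along because differentiating exp(-1/t) produces them. *)
Definition exp_inv (a : nat) (t : R) : R :=
  if 0 < t then t^-1 ^+ a * expR (- t^-1) else 0.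

Lemma exp_inv_gt0 a t : 0 < t -> 0 < exp_inv a t.
Proof. by move=> t0; rewrite /exp_inv t0 mulr_gt0 ?expR_gt0// exprn_gt0 ?invr_gt0. Qed.

Lemma exp_inv_le0 a t : t <= 0 -> exp_inv a t = 0.
Proof. by rewrite /exp_inv ltNge => ->. Qed.

Lemma exp_inv_ge0 a t : 0 <= exp_inv a t.
Proof. by case: (leP t 0) => [/exp_inv_le0->//|/exp_inv_gt0 /ltW]. Qed.

(** With s = 1/t the bound reads s^a / a! <= e^s, a single term of the exponential series. *)
Lemma exp_inv_bounded a t : `|exp_inv a t| <= a`!%:R.
Proof.
rewrite ger0_norm ?exp_inv_ge0//.
case: (leP t 0) => [/exp_inv_le0->//|t0]; rewrite /exp_inv t0.
have s0 : 0 <= t^-1 by rewrite invr_ge0 ltW.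
rewrite expRN ler_pdivrMr ?expR_gt0// -ler_pdivrMl ?ltr0n ?fact_gt0// mulrC.
case: a => [|a]; first by rewrite expr0 fact0 divr1 (le_trans _ (expR_ge1Dx _))// lerDl.
by rewrite (le_trans _ (expR_ge1Dxn a s0))// lerDr.
Qed.

Lemma exp_invS a t : exp_inv a.+1 t = t^-1 * exp_inv a t.
Proof. by rewrite /exp_inv; case: ifP => _; rewrite ?mulr0// exprS mulrA. Qed.

Lemma is_derive_exp_inv (a : nat) (t : R) :
  is_derive t (1 : R) (exp_inv a) (exp_inv a.+2 t - a%:R * exp_inv a.+1 t).
Proof.
have [t0|t0|->] := ltgtP t 0.
- rewrite !exp_inv_le0 ?(ltW t0)// mulr0 subr0.
  apply: (@near_eq_is_derive _ _ _ (cst 0)).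
  by near=> s; rewrite exp_inv_le0//; near: s; exact: lt_le_nbhsl.
- apply: (@near_eq_is_derive _ _ _ (fun s : R => s^-1 ^+ a * expR (- s^-1))).
    by near=> s; rewrite /exp_inv ifT//; near: s; exact: lt_nbhsr.
  have tn0 : t != 0 by rewrite gt_eqF.
  have dV : is_derive t (1 : R) (fun s : R => s^-1) (- t^-2).
    apply: (is_derive_eq (is_deriveV tn0 (is_derive_id t 1))).
    by rewrite /GRing.scale/= mulr1.
  have dE : is_derive t (1 : R) (fun s : R => expR (- s^-1)) (t^-2 * expR (- t^-1)).
    apply: (is_derive_eq (is_derive1_comp (is_derive_expR _) (is_deriveN dV))).
    by rewrite opprK mulrC.
  rewrite (_ : (fun s => _) =
      ((fun s : R => s^-1) ^+ a) * (fun s : R => expR (- s^-1))); last first.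
    by apply/funext => s; rewrite exprfctE.
  apply: (is_derive_eq (is_deriveM (is_deriveX a dV) dE)).
  rewrite exprfctE.
  rewrite /exp_inv t0 /GRing.scale/=.
  rewrite -exprVn; move: (t^-1) (expR _) => s e.
  case: a => [|a]; first by ring.
  by rewrite !exprS/=; ring.
- rewrite !exp_inv_le0// mulr0 subr0.
  (* The difference quotient at 0 equals [h * exp_inv a.+2 h], and the second factor is bounded. *)
  have lim0 : h^-1 *: (exp_inv a (h *: (1 : R) + 0) - exp_inv a 0)
      @[h --> 0^'] --> (0 : R).
    rewrite (_ : (fun _ => _) = fun h : R => h * exp_inv a.+2 h); last first.
      apply/funext => h; rewrite (@exp_inv_le0 a 0)// subr0 addr0 !exp_invS.
      rewrite /GRing.scale/= mulr1.
      have [->|h0] := eqVneq h 0; first by rewrite invr0 !mul0r.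
      by rewrite mulVKf.
    apply/cvgr0Pnorm_lt => e e0; near=> h.
    rewrite normrM (le_lt_trans (ler_wpM2l (normr_ge0 _) (exp_inv_bounded _ _)))//.
    rewrite -ltr_pdivlMr ?ltr0n ?fact_gt0//; near: h.
    apply: dnbhs0_lt; by rewrite divr_gt0// ltr0n fact_gt0.
  by split; [apply/cvg_ex; exists 0|exact: cvg_lim lim0].
Unshelve. all: by end_near. Qed.

End exp_inv.

(** * A smooth bump supported in the unit cube *)

Section bump.
Context {R : realType} {n : nat}.
Implicit Types (f g : 'rV[R]_n -> R) (x v : 'rV[R]_n).

(* All members are bounded and the class is stable under directional
   derivatives, which controls the iterated partial derivatives without
   computing them. *)
Inductive bump_algebra : ('rV[R]_n -> R) -> Prop :=
| bump_cst c : bump_algebra (fun _ => c)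
| bump_exp_inv a (i : 'I_n) s :
    bump_algebra (fun x => exp_inv a (1 + s * x 0 i))
| bump_add f g :
    bump_algebra f -> bump_algebra g -> bump_algebra (fun x => f x + g x)
| bump_mul f g :
    bump_algebra f -> bump_algebra g -> bump_algebra (fun x => f x * g x).

Lemma bump_prod (I : Type) (s : seq I) (F : I -> 'rV[R]_n -> R) :
  (forall i, bump_algebra (F i)) ->
  bump_algebra (fun x => \prod_(i <- s) F i x).
Proof.
move=> bF; elim: s => [|i s IHs].
  rewrite (_ : (fun _ => _) = fun _ => 1); first exact: bump_cst.
  by apply/funext => x; rewrite big_nil.
rewrite (_ : (fun _ => _) = fun x => F i x * \prod_(j <- s) F j x).
  exact: bump_mul.
by apply/funext => x; rewrite big_cons.
Qed.

Lemma differentiable_affine_coord (i : 'I_n) (s : R) x :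
  differentiable (fun y : 'rV[R]_n => 1 + s * y 0 i : R) x.
Proof.
have dc := @differentiable_coord R 1 n x 0 i.
exact: (differentiableD (differentiable_cst (1 : R) x) (differentiableZ s dc)).
Qed.

Lemma derive_affine_coord (i : 'I_n) (s : R) x v :
  'D_v (fun y : 'rV[R]_n => 1 + s * y 0 i : R) x = s * v 0 i.
Proof.
apply: lim_near_cst => //; near=> h.
have h0 : h != 0 by near: h; exact: nbhs_dnbhs_neq.
rewrite /= !mxE opprD addrACA subrr add0r mulrDr addrK /GRing.scale/= mulrCA.
by rewrite mulKf.
Unshelve. all: by end_near. Qed.

Lemma derive_exp_inv_coord a (i : 'I_n) (s : R) x v :
  'D_v (fun y : 'rV[R]_n => exp_inv a (1 + s * y 0 i)) x =
  (s * v 0 i) * (exp_inv a.+2 (1 + s * x 0 i) -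
                 a%:R * exp_inv a.+1 (1 + s * x 0 i)).
Proof.
have dE := is_derive_exp_inv a (1 + s * x 0 i).
have dfE : differentiable (exp_inv a) (1 + s * x 0 i).
  by apply/derivable1_diffP; exact: ex_derive.
have dfl := differentiable_affine_coord i s x.
rewrite deriveE; last exact: (@differentiable_comp _ _ _ _ _ (exp_inv a)).
rewrite (@diff_comp _ _ _ _ _ (exp_inv a))//= -(deriveE v dfl).
rewrite derive_affine_coord -[X in 'd _ _ X]mulr1.
by rewrite [LHS]linearZ -deriveE// derive_val.
Qed.

Lemma bump_algebraP g : bump_algebra g ->
  [/\ forall x, differentiable g x,
      forall v, bump_algebra ('D_v g) &
      exists C, forall x, `|g x| <= C].
Proof.
elim=> [c|a i s|f g' bf [df Df [C fC]] bg [dg Dg [C' gC']]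
  |f g' bf [df Df [C fC]] bg [dg Dg [C' gC']]].
- split; [move=> x; exact: differentiable_cst| |by exists `|c|] => v.
  rewrite (_ : 'D_v _ = fun _ => 0); first exact: bump_cst.
  by apply/funext => x; rewrite derive_cst.
- split=> [x|v|]; last by exists a`!%:R => x; exact: exp_inv_bounded.
  + apply: (@differentiable_comp _ _ _ _ (fun y : 'rV[R]_n => 1 + s * y 0 i)
      (exp_inv a)).
      exact: differentiable_affine_coord.
    apply/derivable1_diffP.
    by have dE := is_derive_exp_inv a (1 + s * x 0 i); exact: ex_derive.
  + rewrite (_ : 'D_v _ = fun x => (s * v 0 i) *
      (exp_inv a.+2 (1 + s * x 0 i) + - a%:R * exp_inv a.+1 (1 + s * x 0 i))).
      by do !(apply: bump_cst || apply: bump_exp_inv || apply: bump_mul ||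
              apply: bump_add).
    by apply/funext => x; rewrite derive_exp_inv_coord mulNr.
- split=> [x|v|]; first exact: (differentiableD (df x) (dg x)).
  + rewrite (_ : 'D_v _ = fun x => 'D_v f x + 'D_v g' x).
      by apply: bump_add.
    by apply/funext => x; rewrite deriveD//; exact: diff_derivable.
  + by exists (C + C') => x; rewrite (le_trans (ler_normD _ _))// lerD.
- split=> [x|v|]; first exact: (differentiableM (df x) (dg x)).
  + rewrite (_ : 'D_v _ = fun x => f x * 'D_v g' x + g' x * 'D_v f x).
      by apply: bump_add; apply: bump_mul.
    by apply/funext => x; rewrite deriveM//; exact: diff_derivable.
  + by exists (C * C') => x; rewrite normrM ler_pM.
Qed.

Lemma bump_partials s f : bump_algebra f -> bump_algebra (partials s f).
Proof. by move=> bf; elim: s => //= i s /bump_algebraP[_ + _]; exact. Qed.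

(** A derivative depends only on the values near the point, and [A] open makes this pass through the
    iteration. It keeps all partials of the bump supported in the cube. *)
Lemma partials_eq0 (A : set 'rV[R]_n) s f : open A ->
  (forall x, A x -> f x = 0) -> forall x, A x -> partials s f x = 0.
Proof.
move=> oA f0; elim: s => [//|i s IHs] x Ax /=.
rewrite (@near_eq_derive _ _ _ _ (cst 0)) ?derive_cst//.
have : \forall y \near x, A y by exact: open_nbhs_nbhs.
by apply: filterS => y /IHs.
Qed.

Lemma open_outside_cube :
  open [set x : 'rV[R]_n | exists i, 1 < `|x 0 i|].
Proof.
have nearP (x : 'rV[R]_n) i : 1 < `|x 0 i| ->
    \forall y \near x, 1 < `|(y : 'rV[R]_n) 0 i|.
  move=> xi; have c : (fun y : 'rV[R]_n => y 0 i) @ x --> x 0 i.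
    exact: (@coord_continuous R 1 n 0 i x).
  exact: (cvgr_gt _ (cvg_norm c)).
rewrite openE => x /= [i /nearP]; apply: filterS => y yi; by exists i.
Qed.

(** The partials are bounded and vanish off the cube, where alone the weight has to be controlled:
    there [enorm x] is at most the square root of n. *)
Lemma bump_real_schwartz f : bump_algebra f ->
  (forall x, (exists i, 1 < `|x 0 i|) -> f x = 0) -> real_schwartz f.
Proof.
move=> bf f0; split=> [s x _|k s].
  have [ds _ _] := bump_algebraP (bump_partials s bf).
  split=> [|i]; last exact: diff_derivable.
  exact: differentiable_continuous.
have [_ _ [C fC]] := bump_algebraP (bump_partials s bf).
have C0 : 0 <= C := le_trans (normr_ge0 _) (fC 0).
exists (Num.sqrt n%:R ^+ k * C) => x.
have [/(partials_eq0 s open_outside_cube f0)->|/forallNP x1] :=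
    pselect (exists i, 1 < `|x 0 i|).
  by rewrite normr0 mulr0 mulr_ge0// exprn_ge0// sqrtr_ge0.
apply: ler_pM => //; first by rewrite exprn_ge0// sqrtr_ge0.
apply: lerXn2r; rewrite ?nnegrE ?sqrtr_ge0//; apply: ler_wsqrtr.
rewrite (le_trans (y := \sum_(i < n) 1))//; last first.
  by rewrite sumr_const card_ord.
apply: ler_sum => i _; have /negP := x1 i; rewrite -leNgt => xi.
by rewrite -real_normK ?num_real// exprn_ile1.
Qed.

(** Each coordinate contributes exp(-1/(1 + x_i)) exp(-1/(1 - x_i)), positive exactly when |x_i| <
    1. The coefficients [1] and [-1] are written out to match [bump_exp_inv]. *)
Definition bump x : R :=
  \prod_(i < n) (exp_inv 0 (1 + 1 * x 0 i) * exp_inv 0 (1 + -1 * x 0 i)).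

Lemma bump_outside x i : 1 <= `|x 0 i| -> bump x = 0.
Proof.
move=> xi; rewrite /bump (bigD1 i)//=.
suff -> : exp_inv 0 (1 + 1 * x 0 i) * exp_inv 0 (1 + -1 * x 0 i) = 0.
  by rewrite mul0r.
move: xi; rewrite ler_normr => /orP[] xi.
  by rewrite [X in _ * X]exp_inv_le0 ?mulr0//; lra.
by rewrite [X in X * _]exp_inv_le0 ?mul0r//; lra.
Qed.

Lemma bump_schwartz : schwartz (fun x => (bump x)%:C%C).
Proof.
split => /=; apply: bump_real_schwartz; [|by move=> x [i /ltW/bump_outside]| |by []].
  by apply: bump_prod => i; apply: bump_mul; exact: bump_exp_inv.
exact: bump_cst.
Qed.

Lemma bump_ge0 x : 0 <= bump x.
Proof. by apply: prodr_ge0 => i _; rewrite mulr_ge0// exp_inv_ge0. Qed.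

Lemma bump_le1 x : bump x <= 1.
Proof.
apply: prodr_ile1 => i _; rewrite mulr_ge0 ?exp_inv_ge0//=.
have le1 t : exp_inv 0 t <= 1 :> R.
  by rewrite (le_trans (ler_norm _))// (le_trans (exp_inv_bounded _ _)).
by rewrite mulr_ile1 ?exp_inv_ge0.
Qed.

(** On this smaller cube 1 + x_i and 1 - x_i are at least 1/2, so each of the two exponentials is at
    least e^(-2). *)
Lemma bump_ge x : (forall i, `|x 0 i| <= 2^-1) -> expR (- 4) ^+ n <= bump x.
Proof.
move=> x2; rewrite -[X in _ ^+ X]card_ord -prodr_const; apply: ler_prod => i _.
rewrite expR_ge0/=; have := x2 i; rewrite ler_norml => /andP[xi1 xi2].
have ge t : 2^-1 <= t -> expR (- 2) <= exp_inv 0 t :> R.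
  move=> t2; have t0 : 0 < t by exact: lt_le_trans t2.
  rewrite /exp_inv t0 expr0 mul1r ler_expR lerN2.
  by rewrite -[leRHS]invrK lef_pV2// posrE.
rewrite (_ : - 4 = - 2 + - 2); last by lra.
by rewrite expRD ler_pM ?expR_ge0//; apply: ge; lra.
Qed.

End bump.

(** * Powers near 1 and the cosine near multiples of pi *)

Section oscillation.
Context {R : realType}.

(** Since q^alpha lies between 1 and q^m, it suffices to bound q^m - 1, which is q - 1 times a sum
    of m powers of q, each at most 2^m. The hypothesis is on q^2 because squared Euclidean norms are
    polynomial. *)
Lemma powR_near1 (alpha q delta : R) (m : nat) :
  0 <= alpha <= m%:R -> 0 <= q -> `|q ^+ 2 - 1| <= delta -> delta < 1 ->
  `|q `^ alpha - 1| <= m%:R * 2 ^+ m * delta.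
Proof.
move=> /andP[alpha0 alpham] q0 q2 delta1.
(* Here |q^2 - 1| = |q - 1| (q + 1) and q + 1 >= 1. *)
have q1delta : `|q - 1| <= delta.
  apply: le_trans q2; rewrite -{2}(expr1n _ 2%N) subr_sqr normrM ler_peMr//.
  by rewrite ger0_norm ?lerDr ?addr_ge0.
have [q_ge q_le] : 1 - delta <= q /\ q <= 1 + delta.
  by move: q1delta; rewrite ler_norml => /andP[]; lra.
have qgt0 : 0 < q by lra.
have qm : `|q `^ alpha - 1| <= `|q ^+ m - 1|.
  rewrite -powR_mulrn//; have [q1|q1] := leP 1 q.
    have qa : 1 <= q `^ alpha by rewrite -[leLHS](powRr0 q) ler_powR.
    have qam : q `^ alpha <= q `^ m%:R by rewrite ler_powR.
    by rewrite !ger0_norm; lra.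
  have q01 : 0 < q <= 1 by rewrite qgt0 ltW.
  have qa : q `^ alpha <= 1 by rewrite -[leRHS](powRr0 q) ger_powR.
  have qam : q `^ m%:R <= q `^ alpha by rewrite ger_powR.
  by rewrite !ler0_norm; lra.
apply: (le_trans qm); rewrite subrX1 normrM mulrC ler_pM//.
apply: (le_trans (ler_norm_sum _ _ _)).
rewrite mulr_natl -[X in _ *+ X]card_ord -sumr_const; apply: ler_sum => i _.
rewrite normrX ger0_norm// (@le_trans _ _ (2 ^+ i))//.
  by rewrite lerXn2r ?nnegrE//; lra.
by rewrite ler_weXn2l ?ler1n// ltnW.
Qed.

(** Shifting by j half-periods gives the sign (-1)^j and leaves cos z with |z| <= 1; the cosine is
    even and decreasing on [0, pi]. *)
Lemma cos_npi_near (j : nat) (y : R) : `|y - pi * j%:R| <= 1 ->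
  cos 1 <= (-1) ^+ j * cos y.
Proof.
rewrite mulr_natr => yj; rewrite -[y](subrK (pi *+ j)).
move: yj; set z := y - _ => z1.
have -> : cos (z + pi *+ j) = (-1) ^+ j * cos z.
  elim: j {z z1} (z) => [|j IHj] z; first by rewrite mulr0n addr0 expr0 mul1r.
  by rewrite mulrSr addrA cosDpi IHj exprS mulN1r mulNr.
rewrite mulrA -exprD addnn -signr_odd odd_double expr0 mul1r -[leRHS]cos_norm.
have pi2 := pi_ge2 R.
by rewrite leNgt ltr_cos -?leNgt// in_itv/= ?normr_ge0; lra.
Qed.

End oscillation.

(** * Euclidean norms of nearby points *)

Section euclidean_norm.
Context {R : realType} {n : nat}.
Implicit Types x t : 'rV[R]_n.

Lemma enorm_ge0 x : 0 <= enorm x.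
Proof. exact: sqrtr_ge0. Qed.

Lemma sqr_enorm x : enorm x ^+ 2 = \sum_(i < n) x 0 i ^+ 2.
Proof. by rewrite sqr_sqrtr//; apply: sumr_ge0 => i _; exact: sqr_ge0. Qed.

Lemma coord_le_enorm x i : `|x 0 i| <= enorm x.
Proof.
rewrite -sqrtr_sqr; apply: ler_wsqrtr; rewrite (bigD1 i)//= lerDl.
by apply: sumr_ge0 => j _; exact: sqr_ge0.
Qed.

Lemma enorm_gt0 x : x != 0 -> 0 < enorm x.
Proof.
move=> x0; rewrite lt0r enorm_ge0 andbT; apply: contra x0 => /eqP x0.
apply/eqP/rowP => i; rewrite mxE; apply/eqP; rewrite -normr_le0 -x0.
exact: coord_le_enorm.
Qed.

Lemma enormZ (c : R) x : 0 <= c -> enorm (c *: x) = c * enorm x.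
Proof.
move=> c0; rewrite /enorm -[c in RHS]ger0_norm// -sqrtr_sqr -sqrtrM ?sqr_ge0//.
rewrite mulr_sumr; congr Num.sqrt; apply: eq_bigr => i _.
by rewrite mxE exprMn.
Qed.

Lemma continuous_enorm : continuous (@enorm R n).
Proof.
have c : continuous (fun x : 'rV[R]_n => \sum_(i < n) x 0 i ^+ 2).
  apply: continuous_big => [|i _ x]; first exact: add_continuous.
  apply: (@continuous_comp _ _ _ (fun y : 'rV[R]_n => y 0 i) (fun a => a ^+ 2)).
    exact: (@coord_continuous R 1 n 0 i x).
  exact: exprn_continuous.
move=> x; apply: (@continuous_comp _ _ _ _ Num.sqrt x (c x)).
exact: sqrt_continuous.
Qed.

(** The difference of squared norms is the sum of (t_i - x_i)(t_i + x_i), where |t_i - x_i| <= 1 and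
    |t_i + x_i| <= 1 + 2|x| <= 3|x|. *)
Lemma enorm_ratio_near1 x t : 1 <= enorm x -> (forall i, `|t 0 i - x 0 i| <= 1) ->
  `|(enorm t / enorm x) ^+ 2 - 1| <= 3 * n%:R / enorm x.
Proof.
move=> x1 tx; have x0 : 0 < enorm x by exact: lt_le_trans x1.
have -> : (enorm t / enorm x) ^+ 2 - 1 =
    (enorm t ^+ 2 - enorm x ^+ 2) / enorm x / enorm x.
  by field; rewrite gt_eqF.
rewrite normrM [X in _ * X]ger0_norm ?invr_ge0 ?enorm_ge0//.
rewrite ler_pM2r ?invr_gt0// normrM [X in _ * X]ger0_norm ?invr_ge0 ?enorm_ge0//.
rewrite ler_pdivrMr//.
rewrite !sqr_enorm -sumrB (le_trans (ler_norm_sum _ _ _))//.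
rewrite -mulrA mulrCA mulr_natl -[X in _ *+ X]card_ord -sumr_const.
apply: ler_sum => i _; rewrite subr_sqr normrM -[leRHS]mul1r.
apply: ler_pM => //.
rewrite (_ : t 0 i + x 0 i = (t 0 i - x 0 i) + 2 * x 0 i); last by ring.
rewrite (le_trans (ler_normD _ _))// normrM (@ger0_norm _ 2)//.
by have := tx i; have := coord_le_enorm x i; lra.
Qed.

(* With [u = pi j / |x|^alpha] the phase [u |t|^alpha] stays close to [pi j] for
   all [t] near [x], as long as [j] is at most a small multiple of [|x|]. *)
Lemma phase_near_npi (alpha : R) (m j : nat) x t :
  0 <= alpha <= m%:R -> 1 <= enorm x -> 3 * n%:R < enorm x ->
  pi * j%:R * (m%:R * 2 ^+ m * (3 * n%:R)) <= enorm x ->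
  (forall i, `|t 0 i - x 0 i| <= 1) ->
  cos 1 <= (-1) ^+ j * cos (pi * j%:R / enorm x `^ alpha * enorm t `^ alpha).
Proof.
move=> alpham x1 xn jx tx; have x0 : 0 < enorm x by exact: lt_le_trans x1.
apply: cos_npi_near.
have q0 : 0 <= enorm t / enorm x by rewrite divr_ge0 ?enorm_ge0.
(* With q = |t|/|x| the phase error is pi j (q^alpha - 1), which [powR_near1] with delta = 3n/|x|
   makes at most 1. *)
rewrite (_ : _ - _ = pi * j%:R * ((enorm t / enorm x) `^ alpha - 1)).
  have pij0 : 0 <= pi * j%:R :> R by rewrite mulr_ge0// ltW// pi_gt0.
  rewrite normrM [X in X * _]ger0_norm//.
  have d1 : 3 * n%:R / enorm x < 1 by rewrite ltr_pdivrMr// mul1r.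
  have := powR_near1 alpham q0 (enorm_ratio_near1 x1 tx) d1.
  move=> /(ler_wpM2l pij0)/le_trans; apply.
  by rewrite !mulrA ler_pdivrMr// mul1r -!mulrA in jx *.
rewrite powRM ?invr_ge0 ?enorm_ge0//.
rewrite -(powR_inv1 (enorm_ge0 x)) powRAC powR_inv1 ?powR_ge0//; ring.
Qed.

End euclidean_norm.

(** * Cubes and their volume *)

Section cubes.
Context {R : realType} {n : nat}.
Implicit Types x t : 'rV[R]_n.

Definition cube x (rho : R) : set 'rV[R]_n :=
  [set t | forall i, `|t 0 i - x 0 i| <= rho].

Lemma cubeE x rho :
  cube x rho = [set t | forall i, `[x 0 i - rho, x 0 i + rho]%classic (t 0 i)].
Proof.
by apply/seteqP; split => t /= tx i; have := tx i; rewrite /= in_itv/= ler_distl.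
Qed.

Lemma measurable_cube x rho : measurable (cube x rho).
Proof.
rewrite (_ : cube x rho = \big[setI/setT]_(i < n)
    ((fun t : 'rV[R]_n => t 0 i) @^-1` `[x 0 i - rho, x 0 i + rho])).
  apply: bigsetI_measurable => i _.
  by rewrite -[X in measurable X]setTI; exact: measurable_coord.
rewrite cubeE -bigcap_seq; apply/seteqP; split => t /= tx i.
  by move=> _; exact: tx.
by apply: (tx i); rewrite /= mem_index_enum.
Qed.

Lemma leb_cube x rho : 0 <= rho -> leb n (cube x rho) = ((2 * rho) ^+ n)%:E.
Proof.
move=> rho0; rewrite cubeE.
rewrite (@leb_box R n (fun i => `[x 0 i - rho, x 0 i + rho]%classic))//.
rewrite (eq_bigr (fun=> (2 * rho)%:E)) => [|i _].
  by rewrite prodEFin prodr_const card_ord.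
rewrite lebesgue_measure_itv/= lte_fin.
case: ltP => [_|]; first by rewrite -EFinB; congr (_%:E); ring.
by move=> h; congr (_%:E); lra.
Qed.

End cubes.

(** * Variation of alternating sequences *)

Section lower_bounds.
Context {R : realType}.

(** The constant sign takes the place of integrability: one of the two parts of [f] has integral 0,
    so no difference of infinities arises. *)
Lemma Rintegral_sign d (T : measurableType d) (mu : {measure set T -> \bar R})
    (D : set T) (k : nat) (f : T -> R) :
  (forall t, 0 <= (-1) ^+ k * f t) ->
  (-1) ^+ k * (\int[mu]_(t in D) f t) = \int[mu]_(t in D) ((-1) ^+ k * f t).
Proof.
rewrite -signr_odd; case: odd => f0; last first.
  by rewrite expr0 mul1r; under [RHS]eq_Rintegral do rewrite mul1r.
rewrite expr1 mulN1r; under [RHS]eq_Rintegral do rewrite mulN1r.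
rewrite /Rintegral -fineN; congr fine.
rewrite -integralN; first by apply: eq_integral => t _; rewrite EFinN.
rewrite [X in (X +? _)%E](_ : _ = 0%E) ?fin_num_adde_defr//.
rewrite integral0_eq// => t _; rewrite funeposE max_r// lee_fin.
by have := f0 t; rewrite expr1 mulN1r oppr_ge0.
Qed.

Lemma Re_le_normc (z : R[i]) : `|complex.Re z| <= Normc.normc z.
Proof.
case: z => a b /=; rewrite -sqrtr_sqr; apply: ler_wsqrtr.
by rewrite lerDl sqr_ge0.
Qed.

(** Consecutive real parts have opposite signs and size at least [A], so each of the N jumps is at
    least 2A, hence at least [A]. The shift [k] leaves room for the sign of the kernel. *)
Lemma Vr_ge_alternating (r A : R) (a : R -> R[i]) (u : nat -> R) (k N : nat) :
  0 < r -> 0 <= A -> (forall j, (j < N)%N -> u j < u j.+1) ->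
  (forall j, (j <= N)%N -> A <= (-1) ^+ (j + k) * complex.Re (a (u j))) ->
  ((N%:R `^ r^-1 * A)%:E <= Vr r [set: R] a)%E.
Proof.
move=> r0 A0 u_incr ua.
apply: (@le_trans _ _ ((\sum_(j < N) Normc.normc (a (u j.+1) - a (u j)) `^ r)
    `^ r^-1)%:E); last by apply: ereal_sup_ubound; exists N, u.
have nA j : (j < N)%N -> A <= Normc.normc (a (u j.+1) - a (u j)).
  move=> jN; apply: le_trans (Re_le_normc _).
  rewrite (_ : complex.Re _ = complex.Re (a (u j.+1)) - complex.Re (a (u j))).
    have := ua _ jN; have := ua _ (ltnW jN).
    rewrite addSn exprS mulN1r mulNr => h1 h2.
    rewrite -[X in _ <= X]mul1r -(normr_sign R (odd (j + k))) -normrM signr_odd.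
    by rewrite mulrBr -normrN (le_trans _ (ler_norm _))//; lra.
  by case: (a _) => ? ?; case: (a _).
have -> : A = (A `^ r) `^ r^-1 by rewrite -powRrM mulfV ?gt_eqF// powRr1.
rewrite lee_fin -powRM ?powR_ge0//; apply: ge0_ler_powR.
- by rewrite invr_ge0 ltW.
- by rewrite nnegrE mulr_ge0// powR_ge0.
- by rewrite nnegrE; apply: sumr_ge0 => j _; exact: powR_ge0.
rewrite mulr_natl -[X in _ *+ X]card_ord -sumr_const; apply: ler_sum => j _.
apply: ge0_ler_powR; rewrite ?nnegrE//; first exact: ltW.
  by apply: le_trans (nA _ (ltn_ord j)).
exact: nA.
Qed.

End lower_bounds.

(** * The operator applied to the bump, far from the origin *)

Section osc_lower_bound.
Context {R : realType} {n : nat}.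
Implicit Types (x t : 'rV[R]_n) (K : 'rV[R]_n -> R).

Lemma bump_cube x t : ~ cube x 1 t -> bump (x - t) = 0.
Proof.
move=> /existsNP[i /negP]; rewrite -ltNge => xi.
by apply: (@bump_outside _ _ _ i); rewrite !mxE distrC ltW.
Qed.

(** The support of t |-> bump (x - t) avoids the unit ball around the singularity, so the truncated
    integrals do not change once e < 1 and the principal value is a plain integral. *)
Lemma Re_osc_bump (alpha u : R) K x : (forall t, cube x 1 t -> 1 <= enorm t) ->
  complex.Re (osc alpha K u (fun y => (bump y)%:C%C) x) =
  \int[leb n]_t (bump (x - t) * cos (u * enorm t `^ alpha) * K t).
Proof.
move=> x1; rewrite /osc /=; apply: lim_near_cst => //; near=> e.
have e1 : e < 1 by near: e; exact: nbhs_right_lt.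
rewrite /truncated_osc /Cintegral /=.
rewrite Rintegral_mkcond; apply: eq_Rintegral => t _.
rewrite /patch; case: ifPn => [_|/negP te]; first by rewrite /=; simpc.
have [/x1 t1|/bump_cube->] := pselect (cube x 1 t); last by rewrite !mul0r.
by exfalso; apply: te; apply/mem_set => /=; exact: lt_le_trans t1.
Unshelve. all: by end_near. Qed.

Lemma Re_osc_bump_ge (alpha u g G : R) (k : nat) K x : 0 <= g ->
  (forall t, cube x 1 t -> 1 <= enorm t) ->
  (forall t, cube x 1 t ->
    g <= (-1) ^+ k * (cos (u * enorm t `^ alpha) * K t) <= G) ->
  expR (- 4) ^+ n * g <=
    (-1) ^+ k * complex.Re (osc alpha K u (fun y => (bump y)%:C%C) x).
Proof.
move=> g0 x1 gG; rewrite Re_osc_bump//.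
pose F t : R := (-1) ^+ k * (bump (x - t) * cos (u * enorm t `^ alpha) * K t).
have FE t : F t = bump (x - t) * ((-1) ^+ k * (cos (u * enorm t `^ alpha) * K t)).
  by rewrite /F; ring.
have F0 t : 0 <= F t.
  rewrite FE; have [/gG/andP[h _]|/bump_cube->] := pselect (cube x 1 t).
    by rewrite mulr_ge0 ?bump_ge0// (le_trans g0).
  by rewrite mul0r.
rewrite Rintegral_sign//.
have G0 : 0 <= G.
  have /gG/andP[h1 h2] : cube x 1 x by move=> i; rewrite subrr normr0.
  by rewrite (le_trans g0)// (le_trans h1).
(* [Rintegral] would turn an infinite integral into 0, which would ruin a lower bound; the upper
   bound [G] rules this out. *)
have Ffin : (\int[leb n]_t (F t)%:E)%E \is a fin_num.
  rewrite ge0_fin_numE; last by apply: integral_ge0 => t _; rewrite lee_fin.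
  apply: (@le_lt_trans _ _ (G%:E * leb n (cube x 1))%E); last first.
    by rewrite leb_cube// -EFinM ltry.
  apply: integral_le_cst => //; first exact: measurable_cube.
  - by move=> t _; rewrite lee_fin.
  - move=> t _ /gG/andP[h1 h2]; rewrite lee_fin FE -[leRHS]mul1r.
    by rewrite ler_pM ?bump_ge0 ?bump_le1// (le_trans g0).
  - by move=> t _ /bump_cube h; rewrite FE h mul0r.
rewrite -lee_fin /Rintegral fineK//.
(* The cube of half-side 1/2, on which the bump is bounded below, has volume 1. *)
have -> : ((expR (- 4) ^+ n * g)%:E = (expR (- 4) ^+ n * g)%:E *
    leb n (cube x 2^-1))%E by rewrite leb_cube ?divff ?expr1n ?mule1.
apply: integral_ge_cst => //; first exact: measurable_cube.
- by rewrite mulr_ge0// exprn_ge0// expR_ge0.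
- by move=> t _; rewrite lee_fin; exact: F0.
move=> t tx; rewrite lee_fin -/(F t) FE.
have /gG/andP[h _] : cube x 1 t.
  by move=> i; rewrite (le_trans (tx i))// invf_le1// ler1n.
rewrite ler_pM ?exprn_ge0 ?expR_ge0//; apply: bump_ge => i.
by rewrite !mxE distrC; exact: tx.
Qed.

(** By continuity K stays within |K x0| / 2 of K x0 near [x0], and K (lam z) = lam^(-n) K z carries
    this to all scales. The radius is twice [rho] so that a unit cube around any point of the cube
    of radius [rho * lam] still fits when [lam] is large. *)
Lemma homogeneous_kernel_bounds K x0 : homogeneous_CZ_kernel K ->
  x0 != 0 -> K x0 != 0 ->
  exists (rho c a : R) (s : nat), [/\ 0 < rho, 0 < c, 0 < a &
    forall lam t, 0 < lam -> cube (lam *: x0) (2 * rho * lam) t ->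
      a * lam <= enorm t /\ c / lam ^+ n <= (-1) ^+ s * K t <= 3 * c / lam ^+ n].
Proof.
move=> [ Omega [sOmega hOmega _ KE]] x00 K0.
have ex0 := enorm_gt0 x00.
have K0' : 0 < `|K x0| / 2 by rewrite divr_gt0// normr_gt0.
have cK : (fun z => Omega z / enorm z ^+ n) @ x0 --> K x0.
  rewrite KE//; have [cOmega _] := sOmega [::] x0 x00.
  have cn : (fun z => enorm z ^+ n) @ x0 --> enorm x0 ^+ n.
    apply: (@continuous_comp _ _ _ (@enorm R n) (fun a => a ^+ n)).
      exact: continuous_enorm.
    exact: exprn_continuous.
  have en0 : enorm x0 ^+ n != 0 by rewrite expf_neq0// gt_eqF.
  exact: (cvgM cOmega (cvgV en0 cn)).
have near_x0 : \forall z \near x0, enorm x0 / 2 < enorm z /\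
    `|K x0 - Omega z / enorm z ^+ n| < `|K x0| / 2.
  near=> z; split; near: z.
    by apply: (cvgr_gt _ (@continuous_enorm R n x0)); lra.
  exact: cvgr_dist_lt.
have /nbhs_ballP[e /= e0 ball_e] := near_x0.
(* With [e / 3] the doubled radius stays below [e]. The last witness is a boolean read as 0 or 1, so
   that (-1)^s is the sign of K x0. *)
exists (e / 3), (`|K x0| / 2), (enorm x0 / 2), (K x0 < 0)%R.
split=> //; [by rewrite divr_gt0|by rewrite divr_gt0|move=> lam t lam0 tx].
have lamn0 : lam != 0 by rewrite gt_eqF.
pose z := lam^-1 *: t.
have tz : t = lam *: z by rewrite scalerA divff// scale1r.
have [z1 z2] : enorm x0 / 2 < enorm z /\
    `|K x0 - Omega z / enorm z ^+ n| < `|K x0| / 2.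
  apply: ball_e; split => // i j; rewrite (ord1 i).
  have := tx j; rewrite tz !mxE -mulrBr normrM (gtr0_norm lam0) mulrC ler_pM2r//.
  by rewrite /ball/= distrC => h; rewrite (le_lt_trans h)//; lra.
have z0 : z != 0.
  apply: contraTneq z1 => ->; rewrite -leNgt.
  by rewrite -(scale0r 0) enormZ// mul0r; lra.
have t0 : t != 0 by rewrite tz scaler_eq0 negb_or lamn0.
rewrite {1}tz enormZ ?(ltW lam0)// mulrC ler_pM2l// ltW//; split => //.
have -> : K t = K z / lam ^+ n.
  rewrite !KE// {1}tz hOmega// tz enormZ ?(ltW lam0)// exprMn invfM mulrA.
  by rewrite mulrAC.
rewrite !mulrA !ler_pM2r ?invr_gt0 ?exprn_gt0//.
move: z2; rewrite -KE// ltr_distl => /andP[].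
case: (ltP (K x0) 0) => Kx0; rewrite ?expr1 ?expr0 ?mulN1r ?mul1r.
  by rewrite ltr0_norm// => h1 h2; apply/andP; split; lra.
by rewrite ger0_norm// => h1 h2; apply/andP; split; lra.
Unshelve. all: by end_near. Qed.

End osc_lower_bound.

(** * Pointwise lower bound and growth in N *)

Section main_estimates.
Context {R : realType} {n : nat}.

(** An infinite norm on the right would make the tested inequality say nothing. The bump is at most
    1 and lives on a cube of finite volume. *)
Lemma Lnorm_bump_fin_num (p : R) : 0 < p ->
  Lnorm (leb n) p%:E (fun x => (Normc.normc ((bump x)%:C%C : R[i]))%:E)
    \is a fin_num.
Proof.
move=> p0; have bE (x : 'rV[R]_n) : Normc.normc ((bump x)%:C%C : R[i]) = bump x.
  by rewrite /= expr0n/= addr0 sqrtr_sqr ger0_norm ?bump_ge0.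
rewrite ge0_fin_numE ?Lnorm_ge0//.
apply: (@lty_poweRy _ _ p); rewrite ?gt_eqF// poweR_Lnorm ?gt_eqF//.
apply: (@le_lt_trans _ _ (1%:E * leb n (cube 0 1))%E); last first.
  by rewrite leb_cube// mul1e ltry.
have absE (x : 'rV[R]_n) :
    (`|(Normc.normc ((bump x)%:C%C : R[i]))%:E| `^ p = (bump x `^ p)%:E)%E.
  by rewrite bE abse_EFin ger0_norm ?bump_ge0.
under eq_integral do rewrite absE.
apply: integral_le_cst => //; first exact: measurable_cube.
- by move=> x _; rewrite lee_fin powR_ge0.
- move=> x _ _; rewrite lee_fin.
  apply: (@le_trans _ _ (1 `^ p)); last by rewrite powR1.
  by apply: ge0_ler_powR; rewrite ?nnegrE ?bump_ge0 ?bump_le1// ltW.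
move=> x _ x1; rewrite (_ : bump x = 0) ?powR0 ?gt_eqF//.
have := @bump_cube R n 0 (- x); rewrite sub0r opprK; apply => x1'; apply: x1.
by move=> i; have := x1' i; rewrite !mxE !subr0 normrN.
Qed.

(** At a fixed [x] the frequencies of [phase_near_npi] supply the alternating sign (-1)^j and the
    kernel supplies the constant sign (-1)^s, as [Vr_ge_alternating] requires. *)
Lemma Vr_osc_bump_ge (alpha r c G : R) (m s N : nat) K (x : 'rV[R]_n) :
  0 <= alpha <= m%:R -> 0 < r -> 0 <= c ->
  1 <= enorm x -> 3 * n%:R < enorm x ->
  pi * N%:R * (m%:R * 2 ^+ m * (3 * n%:R)) <= enorm x ->
  (forall t, cube x 1 t -> 1 <= enorm t) ->
  (forall t, cube x 1 t -> c <= (-1) ^+ s * K t <= G) ->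
  ((N%:R `^ r^-1 * (expR (- 4) ^+ n * (cos 1 * c)))%:E <=
   Vr r [set: R] (fun u => osc alpha K u (fun y => (bump y)%:C%C) x))%E.
Proof.
move=> alpham r0 c0 x1 xn xN t1 cKG; have x0 : 0 < enorm x by exact: lt_le_trans x1.
have cos10 : 0 <= cos 1 :> R by rewrite ltW// cos1_gt0.
pose u (j : nat) : R := pi * j%:R / enorm x `^ alpha.
apply: (@Vr_ge_alternating _ _ _ _ u s) => //.
- by rewrite !mulr_ge0// exprn_ge0// expR_ge0.
- move=> j _; rewrite /u ltr_pM2r ?invr_gt0 ?powR_gt0//.
  by rewrite ltr_pM2l ?pi_gt0// ltr_nat.
move=> j jN; apply: (@Re_osc_bump_ge _ _ _ _ _ G) => //; first by rewrite mulr_ge0.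
move=> t tx; rewrite exprD mulrACA.
have /andP[cK KG] := cKG _ tx.
have xj : pi * j%:R * (m%:R * 2 ^+ m * (3 * n%:R)) <= enorm x.
  apply: le_trans xN; rewrite ler_wpM2r ?mulr_ge0 ?exprn_ge0//.
  by rewrite ler_pM2l ?pi_gt0// ler_nat.
have cosu := phase_near_npi alpham x1 xn xj tx.
rewrite ler_pM//= (le_trans _ KG)// -[leRHS]mul1r ler_wpM2r ?(le_trans c0)//.
rewrite (le_trans (ler_norm _))// normrM normrX normrN1 expr1n mul1r.
by rewrite ler_norml cos_geN1 cos_le1.
Qed.

Lemma powR_archi (e D B : R) (N0 : nat) : 0 < e -> 0 < D ->
  exists2 N : nat, (N0 <= N)%N & B < D * N%:R `^ e.
Proof.
move=> e0 D0; pose y := `|B| / D + 1.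
have y0 : 0 <= y by rewrite addr_ge0// divr_ge0// ltW.
have /archi_boundP yN := powR_ge0 y e^-1.
exists (maxn N0 (Num.bound (y `^ e^-1))); first exact: leq_maxl.
set N := maxn _ _.
have {}yN : y `^ e^-1 <= N%:R.
  by rewrite (le_trans (ltW yN))// ler_nat leq_maxr.
have : y <= N%:R `^ e.
  have -> : y = (y `^ e^-1) `^ e by rewrite -powRrM mulVf ?powRr1// gt_eqF.
  by apply: ge0_ler_powR; rewrite ?nnegrE ?powR_ge0// ltW.
move=> yNe; rewrite mulrC -ltr_pdivrMr// (lt_le_trans _ yNe)//.
by rewrite /y (@le_lt_trans _ _ (`|B| / D)) ?ltrDl// ler_pM2r ?invr_gt0// ler_norm.
Qed.

(** With lam = q N, the left side is the p-th power of the pointwise lower bound times the volume of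
    the cube; collecting the powers of N gives the exponent whose sign decides the theorem. *)
Lemma growth_exponent (p r d b q : R) (N : nat) :
  0 <= d -> (0 < N)%N -> 0 < q ->
  (N%:R `^ r^-1 * (d / (q * N%:R) ^+ n)) `^ p * (b * (q * N%:R)) ^+ n =
  (d / q ^+ n) `^ p * (b * q) ^+ n * N%:R `^ (p / r - p * n%:R + n%:R).
Proof.
move=> d0 N0 q0; have N0' : (0 : R) < N%:R by rewrite ltr0n.
have Nn0 : (N%:R : R) != 0 by rewrite gt_eqF.
rewrite (_ : N%:R `^ r^-1 * _ = d / q ^+ n * N%:R `^ (r^-1 - n%:R)); last first.
  rewrite powRD ?Nn0 ?implybT// powRN powR_mulrn// exprMn; field.
  by rewrite !expf_neq0// gt_eqF.
rewrite powRM ?powR_ge0 ?divr_ge0 ?exprn_ge0 ?(ltW q0)// -powRrM.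
rewrite mulrA [(b * q * N%:R) ^+ n]exprMn.
rewrite [in RHS](powRD (s := n%:R)) ?Nn0 ?implybT//.
rewrite (powR_mulrn n)//.
rewrite (_ : (r^-1 - n%:R) * p = p / r - p * n%:R); last by ring.
by rewrite mulrACA.
Qed.

End main_estimates.

(** * Choice of the scale and contradiction *)

Unset Implicit Arguments.
Set Strict Implicit.

Theorem theorem1p2 (R : realType) (n : nat) (alpha p r : R)
    (K : 'rV[R]_n -> R)
    (hn : (1 <= n)%N) (halpha : 1 < alpha)
    (hK : homogeneous_CZ_kernel K)
    (hK0 : exists x, x != 0 /\ K x != 0)
    (hp : 1 < p) (hr : 1 <= r) (hrp : r < (p / (p - 1)) / n%:R) :
  ~ exists C : R, forall f : 'rV[R]_n -> R[i], schwartz f ->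
      (Lnorm (leb n) p%:E
          (fun x => Vr r [set: R] (fun u => osc alpha K u f x))
        <= C%:E * Lnorm (leb n) p%:E (fun x => (Normc.normc (f x))%:E))%E.
Proof.
move=> [C /(_ _ bump_schwartz)].
have p0 : 0 < p by lra.
have r0 : 0 < r by lra.
have n0 : (0 : R) < n%:R by rewrite ltr0n.
have /fineK <- := @Lnorm_bump_fin_num R n p p0.
rewrite -EFinM; move: (C * _) => M hM.
set V := fun x => Vr _ _ _ in hM.
have {}hM : (\int[leb n]_x `|V x| `^ p <= (M `^ p)%:E)%E.
  rewrite -poweR_Lnorm ?gt_eqF// -poweR_EFin.
  apply: gt0_ler_poweR => //; first exact: ltW.
    by rewrite in_itv/= Lnorm_ge0 leey.
  by rewrite in_itv/= leey andbT (le_trans _ hM)// Lnorm_ge0.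
have [x0 [x00 Kx0]] := hK0.
have [rho [c [a [s [rho0 c0 a0 bounds]]]]] := homogeneous_kernel_bounds hK x00 Kx0.
have [m alpham] : exists m : nat, alpha <= m%:R.
  exists (Num.bound alpha); apply/ltW/archi_boundP; lra.
have m0 : (0 : R) < m%:R by lra.
pose Q0 : R := m%:R * 2 ^+ m * (3 * n%:R).
have Q00 : 0 < Q0 by rewrite /Q0 !mulr_gt0// exprn_gt0.
(* Chosen so that lam = q N gives a lam = pi N Q0, exactly the size of |x| that [phase_near_npi]
   asks for when j = N. *)
pose q := pi * Q0 / a.
have q0 : 0 < q by rewrite divr_gt0// mulr_gt0// pi_gt0.
pose d := expR (- 4) ^+ n * (cos 1 * c).
have d0 : 0 < d by rewrite !mulr_gt0 ?exprn_gt0 ?expR_gt0 ?cos1_gt0.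
(* The exponent is p/r - n (p - 1), so its positivity is r < p'/n rewritten. *)
have e0 : 0 < p / r - p * n%:R + n%:R.
  have : r * n%:R * (p - 1) < p.
    by move: hrp; rewrite ltr_pdivlMr// ltr_pdivlMr//; lra.
  rewrite -mulrA mulrC -ltr_pdivlMr//; lra.
have D0 : 0 < (d / q ^+ n) `^ p * (2 * rho * q) ^+ n.
  apply: mulr_gt0; first by rewrite powR_gt0// divr_gt0// exprn_gt0.
  by rewrite exprn_gt0// mulr_gt0// mulr_gt0.
have [aq0 rhoq0] : 0 < a * q /\ 0 < rho * q by split; exact: mulr_gt0.
have t1 : 0 < 1 / (a * q) by exact: divr_gt0.
have t2 : 0 < 3 * n%:R / (a * q) by rewrite divr_gt0// mulr_gt0.
have t3 : 0 < 1 / (rho * q) by exact: divr_gt0.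
(* The three positive terms are the thresholds for a lam >= 1, a lam > 3n and rho lam >= 1;
   exceeding their sum exceeds each of them. *)
have [N0 N0large] : exists N0 : nat,
    1 / (a * q) + 3 * n%:R / (a * q) + 1 / (rho * q) < N0%:R.
  by eexists; apply: archi_boundP; lra.
have [N N0N MN] := powR_archi (M `^ p) N0 e0 D0.
have Nlarge : 1 / (a * q) + 3 * n%:R / (a * q) + 1 / (rho * q) < N%:R.
  by rewrite (lt_le_trans N0large)// ler_nat.
have Ngt0 : (0 < N)%N by rewrite -(ltr0n R); lra.
pose lam := q * N%:R.
have lam0 : 0 < lam by rewrite mulr_gt0// ltr0n.
have [alam1 alamn rholam] :
    [/\ 1 <= a * lam, 3 * n%:R < a * lam & 1 <= rho * lam].
  have div_lt b y : 0 < b * q -> y / (b * q) < N%:R -> y < b * lam.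
    by move=> bq0; rewrite ltr_pdivrMr// (_ : b * lam = N%:R * (b * q))// /lam; ring.
  by split; try apply/ltW; apply: div_lt => //; lra.
have alamQ : pi * N%:R * Q0 <= a * lam.
  by rewrite /lam /q le_eqVlt; apply/orP; left; apply/eqP; field; rewrite gt_eqF.
have V_ge x : cube (lam *: x0) (rho * lam) x ->
    ((N%:R `^ r^-1 * (d / lam ^+ n))%:E <= V x)%E.
  move=> xlam.
  (* The radii add up to rho lam + 1, at most 2 rho lam because rho lam >= 1. *)
  have cube_sub t : cube x 1 t -> cube (lam *: x0) (2 * rho * lam) t.
    move=> tx i; rewrite -[t 0 i](subrK (x 0 i)) -addrA.
    rewrite (le_trans (ler_normD _ _))// -mulrA mulr_natl mulr2n.
    by rewrite lerD// (le_trans (tx i)).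
  have x_large : a * lam <= enorm x.
    have /cube_sub/bounds-/(_ lam0)[] // : cube x 1 x.
    by move=> i; rewrite subrr normr0.
  rewrite /d -[_ * _ / _]mulrA -[cos 1 * c / _]mulrA.
  apply: (@Vr_osc_bump_ge _ _ _ _ _ (3 * c / lam ^+ n) m s).
  - by rewrite alpham andbT; lra.
  - by [].
  - by rewrite divr_ge0 ?exprn_ge0 ?(ltW c0) ?(ltW lam0).
  - exact: le_trans x_large.
  - exact: lt_le_trans x_large.
  - exact: le_trans x_large.
  - by move=> t /cube_sub/(bounds lam _ lam0)[+ _]; exact: le_trans.
  - by move=> t /cube_sub/(bounds lam _ lam0)[].
have growth := @growth_exponent R n p r d (2 * rho) q N (ltW d0) Ngt0 q0.
move: MN; rewrite -growth -/lam -(mulrA 2) => MN.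
have X0 : 0 <= N%:R `^ r^-1 * (d / lam ^+ n).
  by rewrite mulr_ge0 ?powR_ge0// divr_ge0 ?exprn_ge0 ?(ltW d0) ?(ltW lam0).
(* Only the cube around lam x0 is kept. By [MN] its contribution already exceeds M^p, against
   [hM]. *)
have : (((N%:R `^ r^-1 * (d / lam ^+ n)) `^ p)%:E *
    leb n (cube (lam *: x0) (rho * lam)) <= \int[leb n]_x `|V x| `^ p)%E.
  apply: integral_ge_cst => //.
  - exact: measurable_cube.
  - exact: powR_ge0.
  - by move=> x _; exact: poweR_ge0.
  move=> x /V_ge xV; rewrite -poweR_EFin; apply: gt0_ler_poweR.
  - exact: ltW.
  - by rewrite in_itv/= lee_fin X0 leey.
  - by rewrite in_itv/= abse_ge0 leey.
  - by rewrite (le_trans xV)// lee_abs.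
move=> /le_trans/(_ hM); rewrite leb_cube; last by rewrite mulr_ge0// ltW.
by rewrite -EFinM lee_fin leNgt MN.
Qed.
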